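(* For every integer $n \ge 1$, $$\sum_{t \in M,\ \deg(t) = n} \hat{a}(t) = \omega(n).$$
   Context: Mersenne notation: for $n \ge 1$ let $M_n = 2^n - 1$. The Mersenne factorial is $n!_M = \prod_{i=1}^n M_i$ (with $0!_M = 1$). For $n \ge 1$ put $\omega(n) = \frac{2^{n-1}\,(n-1)!_M}{n!}$. The magma $M$: let $M$ (without index) be the magma with neutral element $1_M$ freely generated by one element $x$ (multiplication neither associative nor commutative). Every $t \in M\setminus\{1_M,x\}$ can be written uniquely as $t = t_1\cdot t_2$ with $t_1,t_2 \in M \setminus\{1_M\}$. The degree $\deg : M \to \mathbb{N}$ is the unique homomorphism with $\deg(1_M)=0$, $\deg(x)=1$ (so $\deg(s\cdot t)=\deg(s)+\deg(t)$). Elements $t \ne 1_M$ of $M$ correspond to finite planar binary rooted trees with $\deg(t)$ leaves. The non-associative exponential: $\mathbb{Q}\{\{x\}\}$ is the $\mathbb{Q}$-algebra of formal series $\sum_{t\in M} c(t)\, t$, $c(t) \in \mathbb{Q}$, with product extending that of $M$. There is a unique series $\exp(x) = \sum_{t \in M} a(t)\, t \in \mathbb{Q}\{\{x\}\}$ of the form $1 + x + (\text{terms of degree} \ge 2)$ with $\exp(x)\cdot\exp(x) = \exp(2x)$, where $\exp(2x) = \sum_t 2^{\deg(t)} a(t)\, t$. Its coefficients are given by $a(1_M)=a(x)=1$ and $a(t_1\cdot t_2) = \frac{a(t_1)a(t_2)}{2^n-2}$ for $t_1,t_2 \ne 1_M$, $n = \deg(t_1\cdot t_2)$. For $t \in M$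 of degree $n \ge 1$ put $\hat{a}(t) = n!\cdot\omega(n)\cdot a(t)$. *)

(* Defs.v *)
From HB Require Import structures.
From mathcomp Require Import all_boot all_order all_algebra.
From mathcomp Require Import boolp classical_sets functions cardinality fsbigop.
From mathcomp Require Import zify ring.

Set Implicit Arguments.
Unset Strict Implicit.
Unset Printing Implicit Defensive.

Import Order.TTheory GRing.Theory Num.Theory.
Local Open Scope classical_set_scope.
Local Open Scope ring_scope.

(** ** The free magma with neutral element on one generator *)

Inductive tree : Type := Leaf | Node of tree & tree.

Fixpoint tree_encode (t : tree) : GenTree.tree unit :=
  match t with
  | Leaf => GenTree.Leaf tt
  | Node l r => GenTree.Node 0 [:: tree_encode l; tree_encode r]
  end.

Fixpoint tree_decode (g : GenTree.tree unit) : option tree :=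
  match g with
  | GenTree.Leaf _ => Some Leaf
  | GenTree.Node _ [:: l; r] =>
      if (tree_decode l, tree_decode r) is (Some l', Some r')
      then Some (Node l' r') else None
  | _ => None
  end.

Lemma tree_encodeK : pcancel tree_encode tree_decode.
Proof. by elim=> [//|l IHl r IHr] /=; rewrite IHl IHr. Qed.

HB.instance Definition _ := Countable.copy tree (pcan_type tree_encodeK).

(* [None] is the neutral element; the non-neutral elements form the free
   (unit-free) magma on one generator, i.e. planar binary rooted trees. *)
Definition magma : Type := option tree.

HB.instance Definition _ := Countable.copy magma (option tree).

Definition mone : magma := None.
Definition mgen : magma := Some Leaf.
Definition mmul (s t : magma) : magma :=
  match s, t with
  | None, _ => t
  | _, None => s
  | Some l, Some r => Some (Node l r)
  end.

Lemma mmul1m : left_id mone mmul.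
Proof. by []. Qed.

Lemma mmulm1 : right_id mone mmul.
Proof. by case. Qed.

Lemma magma_free (U : Type) (e : U) (op : U -> U -> U) (y : U) :
  left_id e op -> right_id e op ->
  exists! f : magma -> U,
    [/\ f mone = e, f mgen = y & {morph f : s t / mmul s t >-> op s t}].
Proof.
move=> op1m opm1.
pose fix g t := match t with Leaf => y | Node l r => op (g l) (g r) end.
exists (fun t => if t is Some t' then g t' else e); split.
  by split=> // -[s|] [t|] //=; rewrite ?op1m ?opm1.
move=> f [f1 fx fM]; apply/funext => -[t|//].
by elim: t => [//|l IHl r IHr] /=; rewrite IHl IHr -fM.
Qed.

Lemma magma_factor (t : magma) : t <> mone -> t <> mgen ->
  exists! p : magma * magma,
    [/\ p.1 <> mone, p.2 <> mone & t = mmul p.1 p.2].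
Proof.
case: t => [[|l r]|] // _ _; exists (Some l, Some r); split=> //.
by case=> -[s|] [u|] [] //= _ _ [-> ->].
Qed.

Fixpoint leaves (t : tree) : nat :=
  if t is Node l r then (leaves l + leaves r)%N else 1%N.

Definition deg (t : magma) : nat := if t is Some t' then leaves t' else 0%N.

Lemma deg_one : deg mone = 0%N. Proof. by []. Qed.

Lemma deg_gen : deg mgen = 1%N. Proof. by []. Qed.

Lemma degM : {morph deg : s t / mmul s t >-> (s + t)%N}.
Proof. by case=> [s|] [t|] //=; rewrite addn0. Qed.

Lemma leaves_gt0 t : (0 < leaves t)%N.
Proof. by elim: t => //= l IHl r IHr; rewrite addn_gt0 IHl. Qed.

(* The finitely supported sum [\sum_(i \in A) F i] is 0 by convention when the
   support is infinite; the next two lemmas show that this never happens for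
   the sums used below. *)
Lemma finite_deg (n : nat) : finite_set [set t : magma | deg t = n].
Proof.
have fin m : finite_set [set t : tree | (leaves t <= m)%N].
  elim: m => [|m IHm].
    by rewrite (_ : mkset _ = set0) // -subset0 => t /=; have := leaves_gt0 t; lia.
  apply: (@sub_finite_set _ _ ([set Leaf] `|`
     (fun p : tree * tree => Node p.1 p.2) @`
       ([set t | (leaves t <= m)%N] `*` [set t | (leaves t <= m)%N]))).
    move=> [|l r] /=; first by left.
    have := leaves_gt0 l; have := leaves_gt0 r => rp lp lr.
    by right; exists (l, r) => //; split=> /=; lia.
  rewrite finite_setU; split; first exact: finite_set1.
  by apply: finite_image; apply: finite_setX.
apply: (@sub_finite_set _ _
  ([set None] `|` Some @` [set t : tree | (leaves t <= n)%N])).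
  by case=> [t|] /= tn; [right; exists t => //; rewrite /= tn | left].
rewrite finite_setU; split; first exact: finite_set1.
exact: finite_image.
Qed.

Lemma finite_factor (t : magma) :
  finite_set [set p : magma * magma | mmul p.1 p.2 = t].
Proof.
apply: (@sub_finite_set _ _ ((mone, t) |` ((t, mone) |`
  [set (if t is Some (Node l r) then (Some l, Some r) else (mone, mone))]))).
  by move=> [[s|] [u|]] /= <-; rewrite ?mmulm1; [right; right|right; left|left|left].
by rewrite !finite_setU; do !split; exact: finite_set1.
Qed.

(** ** Formal series over the magma *)

Definition series : Type := magma -> rat.

Definition series_mul (f g : series) : series :=
  fun t => \sum_(p \in [set p : magma * magma | mmul p.1 p.2 = t])
             f p.1 * g p.2.

(* The series [f (c x)] obtained by substituting [c x] for [x]. *)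
Definition series_dilate (c : rat) (f : series) : series :=
  fun t => c ^+ deg t * f t.

(* [mone] and [mgen] are the only elements of degree at most 1, so the first
   two conditions say that [a] is [1 + x] plus terms of degree at least 2. *)
Definition is_nonassoc_exp (a : series) : Prop :=
  [/\ a mone = 1, a mgen = 1 & series_mul a a = series_dilate 2 a].

Lemma series_mulE (f g : series) (t : magma) :
  series_mul f g t =
  match t with
  | None => f mone * g mone
  | Some t' => f mone * g t + f t * g mone +
      (if t' is Node l r then f (Some l) * g (Some r) else 0)
  end.
Proof.
pose r := match t with
  | None => [:: (mone, mone)]
  | Some Leaf => [:: (mone, t); (t, mone)]
  | Some (Node u v) => [:: (mone, t); (t, mone); (Some u, Some v)]
  end.
have ur : uniq r.
  rewrite /r; case: t {r} => [[|u v]|] //=.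
  by rewrite inE xpair_eqE andbF.
rewrite /series_mul.
rewrite (_ : [set p | _] = [set` r]); last first.
  apply/seteqP; split=> -[p q] /=.
    rewrite /r => <-; case: p q => [p|] [q|] /=; last by rewrite inE.
    - by rewrite !inE eqxx !orbT.
    - by case: p => [|u v]; rewrite !inE eqxx ?orbT.
    - by case: q => [|u v]; rewrite !inE eqxx ?orbT.
  rewrite /r; case: t {r ur} => [[|u v]|] /=; rewrite !inE.
  - by case/orP=> /eqP[-> ->].
  - by case/or3P=> /eqP[-> ->].
  - by move=> /eqP[-> ->].
rewrite -fsbig_seq // /r; case: t {r ur} => [[|u v]|].
- by rewrite !big_cons big_nil /= !addr0.
- by rewrite !big_cons big_nil /= !addr0 addrA.
- by rewrite big_seq1 /=.
Qed.

Lemma exp2_sub2_neq0 n : (2 <= n)%N -> (2 : rat) ^+ n - 2 != 0.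
Proof.
by case: n => [|[|m]] // _; rewrite subr_eq0 gt_eqF // -[ltLHS]expr1 ltr_eXn2l.
Qed.

Lemma nonassoc_exp_node (a : series) (l r : tree) : is_nonassoc_exp a ->
  a (Some (Node l r)) =
  a (Some l) * a (Some r) / (2 ^+ deg (Some (Node l r)) - 2).
Proof.
move=> [a1 _ /(congr1 (fun f => f (Some (Node l r))))].
rewrite series_mulE /series_dilate a1 mul1r mulr1 => aE.
apply: (canRL (mulfK _)).
  by apply: exp2_sub2_neq0; have := leaves_gt0 l; have := leaves_gt0 r => /=; lia.
by rewrite mulrC mulrBl -aE; ring.
Qed.

Lemma nonassoc_exp_exists_unique : exists! a : series, is_nonassoc_exp a.
Proof.
pose fix c t : rat := match t with
  | Leaf => 1
  | Node l r => c l * c r / (2 ^+ leaves (Node l r) - 2)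
  end.
pose a : series := fun t => if t is Some t' then c t' else 1.
exists a; split.
  split=> //; apply/funext => t; rewrite series_mulE /series_dilate.
  case: t => [[|l r]|] /=; [by rewrite !mul1r addr0| |by rewrite !mul1r].
  set d := 2 ^+ _; have : d - 2 != 0.
    by apply: exp2_sub2_neq0; have := leaves_gt0 l; have := leaves_gt0 r; lia.
  by move=> d2; field.
move=> b hb; have [b1 bx _] := hb; apply/funext => -[t|]; last by rewrite b1.
by elim: t => [|l IHl r IHr]; rewrite ?[RHS]bx // [RHS]nonassoc_exp_node // -IHl -IHr.
Qed.

(** ** Mersenne numbers and the normalized coefficients *)

Definition mersenne (n : nat) : nat := (2 ^ n - 1)%N.

Definition mersenne_fact (n : nat) : nat :=
  (\prod_(1 <= i < n.+1) mersenne i)%N.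

(* Only meaningful for [1 <= n]. *)
Definition omega (n : nat) : rat :=
  (2 ^ n.-1 * mersenne_fact n.-1)%N%:R / (n`!)%:R.

Definition ahat (a : series) (t : magma) : rat :=
  ((deg t)`!)%:R * omega (deg t) * a t.

(* Main.v *)
Require Import Defs.
From mathcomp Require Import all_boot all_order all_algebra.
From mathcomp Require Import boolp classical_sets functions cardinality fsbigop.
From mathcomp Require Import zify ring.

(** Specialising every tree to its number of leaves sends a series over the
    magma to an ordinary power series: the coefficient of [z^n] is the sum of
    the coefficients of the elements of degree [n] ([degree_sum]).  Because
    [deg] is additive and has finite fibres, this map turns the magma product
    into the Cauchy product ([degree_sum_mul]).  It commutes with the dilation
    [x |-> 2 x] as well, so the image [A] of the non-associative exponential
    satisfies [A(z)^2 = A(2 z)] with [A(z) = 1 + z + ...].  Reading off the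
    coefficient of [z^n] for [n >= 2] determines [A_n] from the earlier
    coefficients, since [2 ^ n - 2] is nonzero; the usual exponential series
    solves the same recursion by the binomial theorem.  Hence the coefficients
    [a t] with [deg t = n] add up to [1 / n!]
    ([degree_sum_nonassoc_exp]), and the normalisation by [n! * omega n], which
    is constant on each degree, leaves [omega n]. *)

Import Order.TTheory GRing.Theory Num.Theory.
Local Open Scope classical_set_scope.
Local Open Scope ring_scope.

Lemma fsum_fibers (V : nmodType) (I J : choiceType) (P : set I) (Q : set J)
    (h : I -> J) (F : I -> V) :
  finite_set P -> finite_set Q -> (forall i, P i -> Q (h i)) ->
  \sum_(i \in P) F i = \sum_(j \in Q) \sum_(i \in P `&` h @^-1` [set j]) F i.
Proof.
move=> Pfin Qfin PQ; under [RHS]eq_fsbigr do rewrite fsbig_mkcondr.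
rewrite exchange_fsbig //; apply: eq_fsbigr => i /set_mem Pi.
rewrite (fsbigD1 (h i)) //=; last exact: PQ.
rewrite ifT ?inE // fsbig1 ?addr0 // => j [_ /= jNhi].
by case: ifP => // /set_mem /= /esym.
Qed.

Definition degree_sum (f : series) (n : nat) : rat :=
  \sum_(t \in [set t : magma | deg t = n]) f t.

Lemma degree_sum0 (f : series) : degree_sum f 0 = f mone.
Proof.
rewrite /degree_sum (_ : mkset _ = [set mone]) ?fsbig_set1 //.
by apply/seteqP; split=> [[t|]|t ->] //=; have := leaves_gt0 t; lia.
Qed.

Lemma degree_sum1 (f : series) : degree_sum f 1 = f mgen.
Proof.
rewrite /degree_sum (_ : mkset _ = [set mgen]) ?fsbig_set1 //.
apply/seteqP; split=> [[[|l r]|]|t ->] //=.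
by have := leaves_gt0 l; have := leaves_gt0 r; lia.
Qed.

Lemma degree_sum_dilate (c : rat) (f : series) (n : nat) :
  degree_sum (series_dilate c f) n = c ^+ n * degree_sum f n.
Proof.
rewrite /degree_sum mulr_fsumr; apply: eq_fsbigr => t /set_mem /= <-.
by [].
Qed.

(** The pairs of magma elements of total degree [n] can be grouped by the
    product of the two factors, which gives the left-hand side, or by the degree
    of the first factor, which gives the right-hand side. *)
Lemma degree_sum_mul (f g : series) (n : nat) :
  degree_sum (series_mul f g) n =
  \sum_(i < n.+1) degree_sum f i * degree_sum g (n - i)%N.
Proof.
pose S := [set p : magma * magma | (deg p.1 + deg p.2)%N = n].
have fibE i : `I_n.+1 i -> S `&` (fun p => deg p.1) @^-1` [set i] =
    [set t | deg t = i] `*` [set t | deg t = (n - i)%N].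
  by move=> /= iltn; apply/seteqP; split=> -[p q] /= [pE qE];
    split=> //=; move: pE qE; rewrite /S /=; lia.
have Sfin : finite_set S.
  apply: (@sub_finite_set _ _ (\bigcup_(i in `I_n.+1)
    ([set t | deg t = i] `*` [set t | deg t = (n - i)%N]))).
    by move=> [p q] /= pqn; exists (deg p) => //=; [|split=> //=];
      move: pqn; rewrite /S /=; lia.
  apply: bigcup_finite => [|i _]; first exact: finite_II.
  by apply: finite_setX; exact: finite_deg.
transitivity (\sum_(p \in S) f p.1 * g p.2).
  rewrite (@fsum_fibers _ _ _ S [set t | deg t = n] (fun p => mmul p.1 p.2)) //.
  - apply: eq_fsbigr => t /set_mem /= tn; apply: eq_fsbigl.
    apply/seteqP; split=> [p /= pt|p [//]]; split=> //.
    by rewrite /S /= -degM pt.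
  - exact: finite_deg.
  - by move=> p /= pn; rewrite degM.
rewrite (@fsum_fibers _ _ _ S `I_n.+1 (fun p => deg p.1)) //.
- rewrite (fsbig_ord _ n.+1 (fun i => degree_sum f i * degree_sum g (n - i)%N)).
  apply: eq_fsbigr => i /set_mem iltn; rewrite fibE //.
  rewrite -(pair_fsbig _ (fun s t => f s * g t)); try exact: finite_deg.
  by rewrite mulr_fsuml; apply: eq_fsbigr => s _; rewrite mulr_fsumr.
- by move=> p /= <-; lia.
Qed.

(** The coefficients of [exp z * exp z = exp (2 z)] in ordinary power series. *)
Lemma sum_invfact_mul (F : numFieldType) (n : nat) :
  \sum_(i < n.+1) (i`!%:R)^-1 * ((n - i)`!%:R)^-1 = 2 ^+ n / n`!%:R :> F.
Proof.
have fact_neq0 m : m`!%:R != 0 :> F by rewrite pnatr_eq0 -lt0n fact_gt0.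
rewrite -[2]/(1 + 1)%:R natrD exprDn mulr_suml; apply: eq_bigr => i _.
rewrite !expr1n mulr1 -[_ *+ 'C(_, _)]mulr_natr mul1r.
have le_in : (i <= n)%N by rewrite -ltnS.
apply: (mulIf (fact_neq0 n)); rewrite divfK //.
rewrite -[in LHS](bin_fact le_in) !natrM; have := fact_neq0 i.
by have := fact_neq0 (n - i)%N; move=> *; field; apply/andP.
Qed.

Lemma degree_sum_nonassoc_exp (a : series) (n : nat) :
  is_nonassoc_exp a -> degree_sum a n = (n`!%:R)^-1.
Proof.
move=> [a1 ax aa]; have [m] := ubnP n; elim: m n => // m IHm n /ltnSE le_nm.
case: n le_nm => [|[|n]] le_nm.
- by rewrite degree_sum0 a1 invr1.
- by rewrite degree_sum1 ax invr1.
have := degree_sum_mul a a n.+2; rewrite aa degree_sum_dilate.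
(* The two extreme terms of the Cauchy product both equal [degree_sum a n.+2];
   the middle ones are known by induction. *)
rewrite big_ord_recl big_ord_recr /= subn0 subnn degree_sum0 a1 mul1r mulr1.
under eq_bigr => i _.
  rewrite !IHm; [over|have := ltn_ord i; rewrite /bump /=; lia..].
have := sum_invfact_mul rat n.+2.
rewrite big_ord_recl big_ord_recr /= subn0 subnn fact0 invr1 mul1r mulr1.
rewrite /bump /= !add1n => factE sumE.
apply: (mulfI (exp2_sub2_neq0 (isT : 2 <= n.+2)%N)).
by rewrite !mulrBl -factE sumE; ring.
Qed.

Theorem corollary3p6 (a : series) (ha : is_nonassoc_exp a)
  (n : nat) (hn : (1 <= n)%N) :
  \sum_(t \in [set t : magma | deg t = n]) ahat a t = omega n.
Proof.
transitivity (n`!%:R * omega n * degree_sum a n).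
  by rewrite mulr_fsumr; apply: eq_fsbigr => t /set_mem /= <-.
rewrite degree_sum_nonassoc_exp // mulrAC divff ?mul1r //.
by rewrite pnatr_eq0 -lt0n fact_gt0.
Qed.
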